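(* (Dissection Theorem.) As formal power series in $q$ (equivalently, as analytic functions for $|q|<1$), \[ \frac{(-q;q^2)_\infty}{(q^4;q^4)_\infty\,(-q^2;q^4)_\infty^{2}} = F_0(-q^2) + q\,F_1(-q^2), \] where for $i=0,1$ \[ F_i(q) = \frac{1}{(q;q)_\infty}\cdot\frac{1}{(q^{1+2i};q^8)_\infty\,(q^2;q^8)_\infty\,(q^4;q^8)_\infty\,(q^6;q^8)_\infty\,(q^{7-2i};q^8)_\infty}. \]
   Context: Here $(a;q)_\infty=\prod_{j\ge0}(1-aq^j)$. *)

(* Defs.v *)
(* Formal power series in q with integer coefficients,
   represented by their coefficient sequences nat -> int. *)
From HB Require Import structures.
From mathcomp Require Import all_boot all_order all_algebra.
Set Implicit Arguments. Unset Strict Implicit. Unset Printing Implicit Defensive.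
Import Order.TTheory GRing.Theory Num.Theory.
Local Open Scope ring_scope.

Definition series := nat -> int.

Definition strunc (f : series) (n : nat) : {poly int} := \poly_(i < n.+1) f i.

Definition sadd (f g : series) : series := fun n => f n + g n.

Definition smul (f g : series) : series :=
  fun n => \sum_(i < n.+1) f i * g (n - i)%N.

Definition sq : series := fun n => (n == 1%N)%:R.

(* Multiplicative inverse of a series with constant term 1:
   1/f = sum_k (1 - f)^k; the coefficient of q^n only involves k <= n
   and the coefficients of f up to q^n. *)
Definition sinv (f : series) : series :=
  fun n => (\sum_(k < n.+1) (1 - strunc f n) ^+ k)`_n.

(* Substitution q |-> c q^k (k >= 1): f(c q^k). *)
Definition ssubst (c : int) (k : nat) (f : series) : series :=
  fun n => if (k %| n)%N then c ^+ (n %/ k) * f (n %/ k)%N else 0.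

(* The infinite q-Pochhammer symbol (a q^b ; q^c)_oo = prod_{j>=0} (1 - a q^(b + c j)),
   for c >= 1, as a formal power series: the coefficient of q^n only depends on
   the factors with j <= n. *)
Definition qpoch (a : int) (b c : nat) : series :=
  fun n => (\prod_(j < n.+1) (1 - a *: 'X^(b + c * j)%N) : {poly int})`_n.

Definition F (i : nat) : series :=
  smul (sinv (qpoch 1 1 1))
       (sinv (smul (qpoch 1 (1 + 2 * i) 8)
             (smul (qpoch 1 2 8)
             (smul (qpoch 1 4 8)
             (smul (qpoch 1 6 8)
                   (qpoch 1 (7 - 2 * i) 8)))))).

(* Main.v *)
(* By the Jacobi triple product, (-q;q^2)(q^4;q^4) = (-q,-q^3,q^4;q^4) is the sum
   of q^(2n^2-n) over all integers n.  Splitting it by the parity of n gives two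
   theta series of base q^16, and the triple product turns these back into
   (-q^6,-q^10,q^16;q^16) and q (-q^2,-q^14,q^16;q^16).  Dividing by
   ((q^4;q^4)(-q^2;q^4))^2, which is (q;q)^2 at -q^2, and cancelling residue
   classes mod 8 gives F_0(-q^2) and q F_1(-q^2).  Series are compared through
   their truncations, in the rings Z[X]/(X^(n+1)); the triple product is the limit
   of a case of the finite q-binomial theorem. *)
Require Import Defs.
From Stdlib Require Import FunctionalExtensionality.
From mathcomp Require Import all_boot all_order all_algebra zify ring.
Set Implicit Arguments.
Unset Strict Implicit.
Unset Printing Implicit Defensive.
Import GRing.Theory.
Local Open Scope ring_scope.

(** * Congruence of polynomials modulo [X^d] *)

Section CongruenceModXn.
Variable R : comNzRingType.
Implicit Types (p q r : {poly R}) (d e : nat).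

Definition eqmodX d p q := forall i, (i < d)%N -> p`_i = q`_i.

Lemma eqmodX_refl d p : eqmodX d p p.
Proof. by []. Qed.

Lemma eqmodX_sym d p q : eqmodX d p q -> eqmodX d q p.
Proof. by move=> h i lt_i; rewrite h. Qed.

Lemma eqmodX_trans d q p r : eqmodX d p q -> eqmodX d q r -> eqmodX d p r.
Proof. by move=> h1 h2 i lt_i; rewrite h1 ?h2. Qed.

Lemma eqmodX_leq d e p q : (e <= d)%N -> eqmodX d p q -> eqmodX e p q.
Proof. by move=> le_ed h i lt_i; apply/h/(leq_trans lt_i). Qed.

Lemma eqmodXP d p q : eqmodX d p q <-> exists r, p = q + 'X^d * r.
Proof.
split=> [h | [r ->] i lt_i]; last by rewrite coefD coefXnM lt_i addr0.
exists (drop_poly d (p - q)).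
rewrite mulrC -[LHS](subrK q) addrC -{1}(poly_take_drop d (p - q)).
suff -> : take_poly d (p - q) = 0 by rewrite add0r.
apply/polyP=> i; rewrite coef_take_poly coef0.
by case: ifP => // lt_i; rewrite coefB h // subrr.
Qed.

Lemma eqmodXD d p q p' q' :
  eqmodX d p q -> eqmodX d p' q' -> eqmodX d (p + p') (q + q').
Proof. by move=> h h' i lt_i; rewrite !coefD h ?h'. Qed.

Lemma eqmodXM d p q p' q' :
  eqmodX d p q -> eqmodX d p' q' -> eqmodX d (p * p') (q * q').
Proof.
move=> h h' i lt_i; rewrite !coefM; apply: eq_bigr => j _.
by rewrite h ?h' //; have := ltn_ord j; lia.
Qed.

Lemma eqmodX_sum d (I : Type) (s : seq I) (f g : I -> {poly R}) :
  (forall i, eqmodX d (f i) (g i)) ->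
  eqmodX d (\sum_(i <- s) f i) (\sum_(i <- s) g i).
Proof. by move=> h; elim/big_rec2: _ => // i y1 y2 _; apply: eqmodXD. Qed.

Lemma eqmodX_shift d e p q : eqmodX d p q -> eqmodX (e + d) ('X^e * p) ('X^e * q).
Proof.
by move=> h i lt_i; rewrite !coefXnM; case: ltnP => // le_e; apply: h; lia.
Qed.

Lemma eqmodX_Xn d e : (d <= e)%N -> eqmodX d 'X^e 0.
Proof. by move=> le_de i lt_i; rewrite coefXn coef0; case: eqP => //; lia. Qed.

Lemma eqmodX_comp d k (c : R) p q : (0 < k)%N -> eqmodX d p q ->
  eqmodX d (p \Po (c *: 'X^k)) (q \Po (c *: 'X^k)).
Proof.
move=> k_gt0 /eqmodXP[r ->]; rewrite comp_polyD comp_polyM comp_Xn_poly.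
rewrite exprZn -exprM -[X in eqmodX d _ X]addr0.
apply: eqmodXD => //.
rewrite -scalerAl scalerAr -[X in eqmodX d _ X](mul0r (c ^+ d *: (r \Po (c *: 'X^k)))).
by apply: eqmodXM => //; apply: eqmodX_Xn; rewrite leq_pmull.
Qed.

(** The sum telescopes to [1 - (1 - p) ^+ d], and [X] divides [1 - p]. *)
Lemma geometric_inverse d p : p`_0 = 1 ->
  eqmodX d ((\sum_(k < d) (1 - p) ^+ k) * p) 1.
Proof.
move=> p0.
have -> : (\sum_(k < d) (1 - p) ^+ k) * p = 1 - (1 - p) ^+ d.
  by rewrite -[RHS]opprB subrX1 -mulNr mulrC; congr (_ * _); ring.
have : eqmodX 1 p 1 by case=> // _; rewrite p0 coef1.
case/eqmodXP => r ->.
rewrite (_ : 1 - (1 + 'X^1 * r) = 'X * - r); last by rewrite expr1; ring.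
rewrite exprMn -[X in eqmodX d _ X]addr0; apply: eqmodXD => //.
rewrite -mulrN -[X in eqmodX d _ X](mul0r (- (- r) ^+ d)).
by apply: eqmodXM => //; apply: eqmodX_Xn.
Qed.

Lemma eqmodX_cancel d p q r : r`_0 = 1 -> eqmodX d (r * p) (r * q) -> eqmodX d p q.
Proof.
move=> /(@geometric_inverse d); set s := \sum_(k < d) _ => sr h.
have mul1 t : eqmodX d t (s * (r * t)).
  by rewrite mulrA -{1}(mul1r t); apply: eqmodXM => //; apply: eqmodX_sym.
apply: (eqmodX_trans (mul1 p)); apply: (@eqmodX_trans _ (s * (r * q))).
  exact: eqmodXM.
exact/eqmodX_sym/mul1.
Qed.

Lemma in_qpolyXn_eq d p q :
  in_qpoly 'X^(d.+1) p = in_qpoly 'X^(d.+1) q <-> eqmodX d.+1 p q.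
Proof.
have monX : 'X^(d.+1) \is @monic R by exact: monicXn.
split=> [/(congr1 val) /= | /eqmodXP[r ->]].
  rewrite mk_monic_Xn => h.
  rewrite (Pdiv.RingMonic.rdivp_eq monX p) (Pdiv.RingMonic.rdivp_eq monX q) h => i lt_i.
  by rewrite !coefD !(mulrC _ 'X^_) !coefXnM lt_i.
rewrite in_qpolyD; suff -> : in_qpoly 'X^(d.+1) ('X^(d.+1) * r) = 0 by rewrite addr0.
apply: val_inj => /=; rewrite mk_monic_Xn mulrC.
exact: Pdiv.RingMonic.rmodp_mull.
Qed.

End CongruenceModXn.

(** * Gaussian binomials and the finite q-binomial theorem *)

Section QBinomial.
Variables (R : comNzRingType) (x : R).

(** The Gaussian binomial, defined by a q-Pascal rule because [R] need not allow division by
    q-factorials. *)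
Fixpoint qbinom n m : R :=
  match n, m with
  | _, 0 => 1
  | 0, _.+1 => 0
  | n'.+1, m'.+1 => qbinom n' m'.+1 + x ^+ (n' - m') * qbinom n' m'
  end.

Arguments qbinom : simpl never.

Definition qfact n := \prod_(j < n) (1 - x ^+ j.+1).

Lemma qfactS n : qfact n.+1 = qfact n * (1 - x ^+ n.+1).
Proof. exact: big_ord_recr. Qed.

Lemma qbinom0 n : qbinom n 0 = 1.
Proof. by case: n. Qed.

Lemma qbinomS n m :
  qbinom n.+1 m.+1 = qbinom n m.+1 + x ^+ (n - m) * qbinom n m.
Proof. by []. Qed.

Lemma qbinom_small n m : (n < m)%N -> qbinom n m = 0.
Proof.
elim: n m => [|n IHn] [|m] // lt_nm.
by rewrite qbinomS !IHn ?mulr0 ?addr0 //; lia.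
Qed.

Lemma qbinomnn n : qbinom n n = 1.
Proof. by elim: n => // n IHn; rewrite qbinomS IHn qbinom_small // subnn; ring. Qed.

(** The q-factorial formula without division; the induction rests on
    [1 - a * b = (1 - a) + a * (1 - b)]. *)
Lemma qbinom_qfact n m : qbinom (n + m) m * (qfact m * qfact n) = qfact (n + m).
Proof.
have qfact0 : qfact 0 = 1 by exact: big_ord0.
elim: n m => [m|n IHn]; first by rewrite add0n qbinomnn qfact0; ring.
elim=> [|m IHm]; first by rewrite addn0 qbinom0 qfact0; ring.
rewrite addSn addnS qbinomS qfactS.
have -> : ((n + m).+1 - m = n.+1)%N by lia.
have -> : qfact (n + m).+2 = (1 - x ^+ n.+1 * x ^+ m.+1) * qfact (n + m).+1.
  by rewrite qfactS -exprD mulrC addSn addnS.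
have := IHn m.+1; have := IHm; rewrite addSn addnS !qfactS.
set f := qfact m; set g := qfact n; set a := x ^+ n.+1; set b := x ^+ m.+1.
set h := qfact _ * _; move=> e1 e2.
transitivity ((1 - a) * (qbinom (n + m).+1 m.+1 * (f * (1 - b) * g)) +
  a * (1 - b) * (qbinom (n + m).+1 m * (f * (g * (1 - a))))); first by ring.
by rewrite e1 e2; ring.
Qed.

(** Homogeneity in [u] and [v] lets a power of [X] stand in for the negative power of q that the
    triple product would otherwise call for. *)
Lemma qbinomial_theorem n (u v : R) :
  \prod_(j < n) (u + v * x ^+ j) =
  \sum_(m < n.+1) x ^+ 'C(m, 2) * qbinom n m * u ^+ (n - m) * v ^+ m.
Proof.
elim: n => [|n IHn]; first by rewrite big_ord0 big_ord1 qbinom0 !expr0; ring.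
rewrite big_ord_recr /= {}IHn mulrDr !big_distrl /= [in RHS]big_ord_recl.
rewrite [in LHS]big_ord_recl [X in _ + X]big_ord_recr [X in _ = _ + X]big_ord_recr /=.
rewrite !qbinom0 /bump /= !subn0 subnn.
(* [A] comes from the factor [u] and [B] from [v * x ^+ n]; the q-Pascal rule merges them into
   [C]. *)
set A := (X in _ + X + _); set B := \sum_(i < n) _; set C := \sum_(i < n) _.
have -> : C = A + B.
  rewrite -big_split; apply: eq_bigr => i _ /=.
  have lt_i := ltn_ord i.
  rewrite !add1n qbinomS binS bin1 subSS.
  have en : (n = i.+1 + (n - i.+1))%N by lia.
  have -> : (n - i = (n - i.+1).+1)%N by lia.
  rewrite [in x ^+ n]en; move: (n - i.+1)%N => k.
  by rewrite !exprD !exprS; ring.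
by rewrite !add1n !qbinomnn subnn binS bin1 exprD !exprS; ring.
Qed.

End QBinomial.

Arguments qbinom {R} x n m : simpl never.

(** * Residue classes and finite Pochhammer products *)

Lemma big_residues (T : Type) (idx : T) (op : Monoid.com_law idx) m N (f : nat -> T) :
  \big[op/idx]_(j < m * N) f j =
  \big[op/idx]_(i < m) \big[op/idx]_(j < N) f (i + m * j)%N.
Proof.
rewrite exchange_big /=; elim: N => [|N IHN]; first by rewrite muln0 !big_ord0.
rewrite mulnSr big_split_ord /= IHN [in RHS]big_ord_recr /=; congr (op _ _).
by apply: eq_bigr => i _; rewrite addnC.
Qed.

Section FinitePochhammer.
Variable R : comNzRingType.

Definition fpoch (a : R) b c N : {poly R} := \prod_(j < N) (1 - a *: 'X^(b + c * j)).

Lemma fpochS (a : R) b c N :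
  fpoch a b c N.+1 = fpoch a b c N * (1 - a *: 'X^(b + c * N)).
Proof. exact: big_ord_recr. Qed.

Lemma fpoch_residues m (a : R) b c N :
  fpoch a b c (m * N) = \prod_(i < m) fpoch a (b + c * i) (c * m) N.
Proof.
rewrite /fpoch (big_residues _ _ _ (fun j => 1 - a *: 'X^(b + c * j))).
by do 2![apply: eq_bigr => ? _]; rewrite mulnDr mulnA addnA.
Qed.

(** With [z ^+ c = 1], the scalar [z ^+ (b + c * j)] does not depend on [j]. *)
Lemma fpoch_comp (z a : R) b c k N : z ^+ c = 1 ->
  fpoch a b c N \Po (z *: 'X^k) = fpoch (a * z ^+ b) (k * b) (k * c) N.
Proof.
move=> zc; rewrite /fpoch rmorph_prod /=; apply: eq_bigr => j _.
rewrite comp_polyB comp_polyC comp_polyZ comp_Xn_poly exprZn -exprM scalerA.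
by rewrite exprD exprM zc expr1n mulr1 mulnDr mulnA.
Qed.

Lemma fpoch_stable (a : R) b c d N M : (0 < c)%N -> (d <= N <= M)%N ->
  eqmodX d (fpoch a b c M) (fpoch a b c N).
Proof.
move=> c_gt0 /andP[le_dN]; elim: M => [|M IHM]; first by rewrite leqn0 => /eqP->.
rewrite leq_eqVlt => /orP[/eqP-> // | le_NM].
apply: eqmodX_trans (IHM le_NM); rewrite fpochS -[X in eqmodX _ _ X]mulr1.
apply: eqmodXM => // i lt_i; rewrite coefB coefZ coefXn.
by case: eqP => [|_]; [nia | rewrite mulr0 subr0].
Qed.

Lemma fpoch_coef0 (a : R) b c N : (0 < b)%N -> (fpoch a b c N)`_0 = 1.
Proof.
move=> b_gt0; rewrite -horner_coef0 /fpoch horner_prod big1 // => j _.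
by rewrite !hornerE expr0n; case: eqP => [|_]; [lia | rewrite mulr0 subr0].
Qed.

Lemma fpoch_qfact k N : fpoch 1 k k N = qfact 'X^k N.
Proof.
by apply: eq_bigr => j _; rewrite scale1r -exprM mulnS.
Qed.

End FinitePochhammer.

(** * Jacobi triple product and dissection of theta series *)

Section JacobiTripleProduct.
Variable R : comNzRingType.

(** Here [B] plays the Gaussian binomial of [s + t] over [s]. Modulo [X^(k * s.+1)] all q-factorials
    of index at least [s] coincide; their constant term is 1, so one of them can be cancelled. *)
Lemma eqmodX_qbinom k s t N (B : {poly R}) : (0 < k)%N -> (s <= t)%N -> (s <= N)%N ->
  B * (qfact 'X^k t * qfact 'X^k s) = qfact 'X^k (s + t) ->
  eqmodX (k * s.+1) (B * qfact 'X^k N) 1.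
Proof.
move=> k_gt0 le_st le_sN eB.
have stable M : (s <= M)%N ->
    eqmodX (k * s.+1) (qfact 'X^k M) (qfact ('X^k : {poly R}) s).
  elim: M => [|M IHM]; first by rewrite leqn0 => /eqP->.
  rewrite leq_eqVlt => /orP[/eqP-> // | le_sM].
  apply: eqmodX_trans (IHM le_sM); rewrite qfactS -[X in eqmodX _ _ X]mulr1.
  apply: eqmodXM => //; rewrite -exprM -[X in eqmodX _ _ X]subr0.
  by move=> i lt_i; rewrite !coefB (@eqmodX_Xn _ (k * s.+1)%N) // leq_pmul2l.
apply: (@eqmodX_cancel _ _ _ _ (qfact 'X^k s)).
  by rewrite -fpoch_qfact fpoch_coef0.
rewrite mulr1.
apply: (@eqmodX_trans _ _ (qfact 'X^k (s + t))); last exact/stable/leq_addr.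
rewrite -eB [X in eqmodX _ X]mulrC -mulrA; apply: eqmodXM => //; apply: eqmodXM => //.
by apply: (@eqmodX_trans _ _ (qfact 'X^k s)); [exact: stable | exact/eqmodX_sym/stable].
Qed.

Definition theta_exp a k j := (a * j + k * 'C(j, 2))%N.

(* Truncation of the sum of X^(a j + (a + b) j (j - 1) / 2) over all integers j;
   the index -j contributes the exponent b j + (a + b) j (j - 1) / 2. *)
Definition theta a b N : {poly R} :=
  \sum_(j < N) 'X^(theta_exp a (a + b) j) + \sum_(j < N) 'X^(theta_exp b (a + b) j.+1).

Lemma bin2D m n : 'C(m + n, 2) = ('C(m, 2) + 'C(n, 2) + m * n)%N.
Proof.
elim: m => [|m IHm]; first by rewrite !mul0n add0n bin0n; lia.
by rewrite addSn !binS !bin1 IHm; nia.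
Qed.

Lemma finite_jacobi_triple a b M (N := M.+1) (x := 'X^(a + b) : {poly R}) :
  fpoch (-1) a (a + b) N * fpoch (-1) b (a + b) N =
  \sum_(i < N) 'X^(theta_exp b (a + b) i.+1) * qbinom x (N + N) (M - i) +
  \sum_(j < N.+1) 'X^(theta_exp a (a + b) j) * qbinom x (N + N) (N + j).
Proof.
rewrite {}/x; set k := (a + b)%N.
pose A := (k * M + b)%N; pose S := (A * N + k * 'C(N, 2))%N.
(* The exponent A makes the product over N + N factors symmetric about j = N,
   up to the monomial X^S. *)
have := qbinomial_theorem ('X^k : {poly R}) (N + N) 'X^A 1.
under eq_bigr => j _ do rewrite mul1r -exprM.
rewrite big_split_ord /=.
(* Pulling [X^(k * j)] out of factor [j] leaves [1 + X^(b + k * (M - j))], a factor of the reversed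
   product. *)
have -> : \prod_(j < N) ('X^A + 'X^(k * j)) =
    'X^(k * 'C(N, 2)) * fpoch (-1) b k N :> {poly R}.
  rewrite /fpoch [X in _ = _ * X](reindex_inj rev_ord_inj) /=.
  rewrite -bin2_sum big_mkord big_distrr /= expr_sum -big_split; apply: eq_bigr => j _ /=.
  rewrite subSS scaleN1r opprK mulrDr mulr1 -exprD addrC; congr (_ + 'X^_).
  rewrite /A; case: j => j /= lt_j; have le_j : (j <= M)%N by [].
  by rewrite -{1}(subnK le_j); nia.
(* Since [k * N - A = a], pulling out [X^A] leaves [1 + X^(a + k * j)]. *)
have -> : \prod_(j < N) ('X^A + 'X^(k * (N + j))) =
    'X^(A * N) * fpoch (-1) a k N :> {poly R}.
  have -> : 'X^(A * N) = \prod_(j < N) 'X^A :> {poly R}.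
    by rewrite prodr_const card_ord exprM.
  rewrite -big_split.
  apply: eq_bigr => j _ /=.
  rewrite scaleN1r opprK mulrDr mulr1 -exprD; congr (_ + 'X^_).
  by rewrite /A /N /k; nia.
have -> : 'X^(k * 'C(N, 2)) * fpoch (-1) b k N * ('X^(A * N) * fpoch (-1) a k N) =
  (fpoch (-1) a k N * fpoch (-1) b k N) * 'X^S :> {poly R} by rewrite exprD; ring.
(* [drop_poly S] cancels the common factor [X^S]. The binomial indices below [N], written [M - i],
   then give the first sum, and those of the form [N + j] the second. *)
move=> e; rewrite -[LHS](drop_polyMXn_id S) e -[RHS](drop_polyMXn_id S); congr drop_poly.
rewrite -addnS big_split_ord /= (reindex_inj rev_ord_inj) mulrDl !big_distrl /=.
congr (_ + _); apply: eq_bigr => -[j /= lt_j] _;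
  rewrite expr1n mulr1 -!exprM mulrAC [RHS]mulrAC -!exprD.
- rewrite subSS; congr ('X^_ * _).
  have le_j : (j <= M)%N by [].
  have eM : (M = j + (M - j))%N by lia.
  have -> : (N + N - (M - j) = N + j.+1)%N by rewrite /N; lia.
  rewrite /S /theta_exp mulnDr.
  have -> : 'C(N, 2) = ('C(M - j, 2) + 'C(j.+1, 2) + (M - j) * j.+1)%N.
    by rewrite -bin2D; congr 'C(_, _); rewrite /N; lia.
  have : (2 * 'C(j.+1, 2) = j.+1 * j)%N by rewrite mul2n bin2 halfK oddM /= andNb subn0.
  have -> : A = (k * (j + (M - j)) + b)%N by rewrite /A -eM.
  move: (M - j)%N 'C(j.+1, 2) 'C((M - j)%N, 2) => i c c' ec.
  have : (k * (2 * c) = k * (j.+1 * j))%N by rewrite ec.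
  by lia.
- congr ('X^_ * _).
  have -> : (N + N - (N + j) = N - j)%N by lia.
  rewrite /S /theta_exp bin2D.
  have eN : (N = j + (N - j))%N by lia.
  have -> : A = (k * N - a)%N by rewrite /A /N /k; nia.
  have le_a : (a <= k * N)%N by rewrite /N /k; nia.
  move: (k * N - a)%N (subnK le_a) eN => A' eA.
  move: (N - j)%N => i eN.
  have : (k * N * j = A' * j + a * j)%N by rewrite -eA mulnDl.
  have : (A' * N = A' * i + A' * j)%N by rewrite eN; nia.
  by lia.
Qed.

(** Each Gaussian binomial times the third product is 1 to a precision that drops towards the ends
    of the sums; there the monomial in front, of exponent at least its index, makes up for the
    loss. *)
Theorem jacobi_triple a b d N : (0 < a)%N -> (0 < b)%N -> (0 < d <= N)%N ->
  eqmodX d (fpoch (-1) a (a + b) N * fpoch (-1) b (a + b) N * fpoch 1 (a + b) (a + b) N)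
    (theta a b N).
Proof.
move=> a_gt0 b_gt0; case: N => [|M]; first by lia.
move=> /andP[_ le_d]; set N := M.+1 in le_d *.
rewrite finite_jacobi_triple mulrDl !big_distrl /= /theta addrC; set k := (a + b)%N.
have k_gt0 : (0 < k)%N by rewrite /k; lia.
have term c s j (B : {poly R}) : (0 < c)%N -> (N <= j + s)%N ->
    eqmodX (k * s) (B * fpoch 1 k k N) 1 ->
  eqmodX d ('X^(theta_exp c k j) * B * fpoch 1 k k N) 'X^(theta_exp c k j).
  move=> c_gt0 le_N h; rewrite -mulrA -[X in eqmodX d _ X]mulr1.
  apply: eqmodX_leq (eqmodX_shift (e := theta_exp c k j) h).
  by rewrite /theta_exp; nia.
(* The summand [j = N] has no counterpart in [theta]; its exponent is at least [N], so it vanishes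
   modulo [X^d]. *)
rewrite big_ord_recr /= -addrA; apply: eqmodXD; last first.
  rewrite -[X in eqmodX _ _ X]add0r; apply: eqmodXD.
  - apply: (@eqmodX_trans _ _ 'X^(theta_exp a k N)); last first.
      by apply: eqmodX_Xn; rewrite /theta_exp; nia.
    apply: (term _ 1%N) => //; first by lia.
    rewrite fpoch_qfact.
    apply: (@eqmodX_qbinom k 0 (N + N)) => //.
    exact: (qbinom_qfact _ 0).
  - apply: eqmodX_sum => -[j /= lt_j]; apply: (term _ (M - j).+1) => //.
      by rewrite /N; lia.
    rewrite fpoch_qfact; apply: (@eqmodX_qbinom k (M - j) (N + j.+1)) => //;
      try (rewrite /N; lia).
    have -> : (N + N = (N + j.+1) + (M - j))%N by rewrite /N; lia.
    by rewrite [X in _ * X]mulrC qbinom_qfact addnC.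
apply: eqmodX_sum => -[j /= lt_j]; apply: (term _ (N - j).+1) => //; first by lia.
rewrite fpoch_qfact.
apply: (@eqmodX_qbinom k (N - j) (N + j)) => //; try lia.
have -> : (N + N = (N - j) + (N + j))%N by lia.
exact: qbinom_qfact.
Qed.

(** The second sum of [theta] runs over [j.+1], so there even [j] are the odd indices and feed
    [theta 14 2], while odd [j] feed [theta 6 10]. Each class gets exactly [N] terms, so the
    identity holds without truncation error. *)
Lemma theta_dissection N :
  theta 1 3 (2 * N) = theta 6 10 N + 'X * theta 14 2 N.
Proof.
rewrite /theta (big_residues _ _ _ (fun j => 'X^(theta_exp _ _ j) : {poly R})).
rewrite (big_residues _ _ _ (fun j => 'X^(theta_exp _ _ j.+1) : {poly R})).
rewrite !big_ord_recl !big_ord0 /= !addr0 mulrDr !big_distrr /=.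
have exp2 m : (2 * 'C(m, 2) + m = m * m)%N.
  by case: m => // m; rewrite mul2n bin2 halfK oddM /= andNb; nia.
rewrite [RHS]addrACA [X in _ = _ + X]addrC.
congr ((_ + _) + (_ + _)); apply: eq_bigr => j _; rewrite -?exprS;
  congr 'X^_; rewrite /theta_exp /bump /=.
- by have := exp2 (0 + 2 * j)%N; have := exp2 (nat_of_ord j); nia.
- by have := exp2 (1 + 0 + 2 * j)%N; have := exp2 (nat_of_ord j); nia.
- by have := exp2 (0 + 2 * j).+1; have := exp2 j.+1; nia.
- by have := exp2 (1 + 0 + 2 * j).+1; have := exp2 j.+1; nia.
Qed.

End JacobiTripleProduct.

(** * Truncations of the series operations *)

Lemma strunc_eqmodX (f : series) d n : (d <= n)%N ->
  eqmodX d.+1 (strunc f n) (strunc f d).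
Proof.
by move=> le_d i lt_i; rewrite !coef_poly lt_i (leq_trans lt_i).
Qed.

Lemma strunc_coef0 (f : series) n : (strunc f n)`_0 = f 0%N.
Proof. by rewrite coef_poly. Qed.

Lemma strunc_sadd f g n : strunc (sadd f g) n = strunc f n + strunc g n.
Proof.
apply/polyP=> i; rewrite coefD !coef_poly.
by case: ifP; rewrite ?addr0.
Qed.

Lemma strunc_smul f g n :
  eqmodX n.+1 (strunc (smul f g) n) (strunc f n * strunc g n).
Proof.
move=> i lt_i; rewrite coef_poly lt_i coefM; apply: eq_bigr => -[j /= lt_j] _.
by rewrite !coef_poly !ifT //; lia.
Qed.

Lemma strunc_sinv f n : f 0%N = 1 ->
  eqmodX n.+1 (strunc (sinv f) n * strunc f n) 1.
Proof.
move=> f0.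
have inv m : eqmodX m.+1 ((\sum_(k < m.+1) (1 - strunc f m) ^+ k) * strunc f m) 1.
  by apply: geometric_inverse; rewrite strunc_coef0.
apply: eqmodX_trans (inv n); apply: eqmodXM => // i lt_i.
rewrite coef_poly lt_i /sinv.
(* [sinv] reads coefficient [i] off the truncation at [i], not at [n]; both geometric sums invert
   [strunc f i] modulo [X^(i.+1)], hence agree there. *)
suff h : eqmodX i.+1 (\sum_(k < i.+1) (1 - strunc f i) ^+ k)
    (\sum_(k < n.+1) (1 - strunc f n) ^+ k) by apply: h.
apply: (@eqmodX_cancel _ _ _ _ (strunc f i)); first by rewrite strunc_coef0.
rewrite mulrC; apply: eqmodX_trans (inv i) _; apply: eqmodX_sym.
rewrite mulrC; apply: eqmodX_trans (eqmodX_leq lt_i (inv n)).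
by apply: eqmodXM => //; apply/eqmodX_sym/strunc_eqmodX.
Qed.

(** [N] stays free so that a product about to be split into [m] classes can be given [m * n.+1]
    factors. *)
Lemma strunc_qpoch a b c n N : (0 < c)%N -> (n < N)%N ->
  eqmodX n.+1 (strunc (qpoch a b c) n) (fpoch a b c N).
Proof.
move=> c_gt0 lt_nN i lt_i; rewrite coef_poly lt_i.
by symmetry; apply: (@fpoch_stable _ a b c i.+1) => //; rewrite leqnn /=; lia.
Qed.

Lemma strunc_ssubst c k f n : (0 < k)%N ->
  eqmodX n.+1 (strunc (ssubst c k f) n) (strunc f n \Po (c *: 'X^k)).
Proof.
move=> k_gt0 i lt_i; rewrite coef_poly lt_i /ssubst.
rewrite /strunc poly_def raddf_sum coef_sum /=.
under eq_bigr => j _ do rewrite comp_polyZ comp_Xn_poly exprZn -exprM !coefZ coefXn.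
case: dvdnP => [[m e]|ndvd].
  have lt_m : (m < n.+1)%N by apply: leq_ltn_trans lt_i; rewrite e leq_pmulr.
  rewrite e mulnK // (bigD1 (Ordinal lt_m)) //= mulnC eqxx mulr1 mulrC.
  rewrite big1 ?addr0 // => j.
  rewrite -val_eqE /= => /eqP ne_j; case: eqP => [/eqP|]; last by rewrite !mulr0.
  by rewrite eqn_pmul2l // => /eqP; lia.
rewrite big1 // => j _; case: eqP => [e|_]; last by rewrite !mulr0.
by case: ndvd; exists j; rewrite e mulnC.
Qed.

(** * Series in the quotient rings Z[X]/(X^(n+1)) *)

Section Residue.
Variable n : nat.

(** The quotient turns congruences into equalities in a commutative ring, open to [rewrite] and
    [ring]. *)
Definition residue (f : series) : {poly %/ ('X^(n.+1) : {poly int})} :=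
  in_qpoly 'X^(n.+1) (strunc f n).

Lemma residue_eqmodX f p : eqmodX n.+1 (strunc f n) p ->
  residue f = in_qpoly 'X^(n.+1) p.
Proof. by move/in_qpolyXn_eq. Qed.

Lemma residueD f g : residue (sadd f g) = residue f + residue g.
Proof. by rewrite /residue strunc_sadd in_qpolyD. Qed.

Lemma residueM f g : residue (smul f g) = residue f * residue g.
Proof. by rewrite -in_qpolyM; apply/residue_eqmodX/strunc_smul. Qed.

Lemma residueV f : f 0%N = 1 -> residue (sinv f) * residue f = 1.
Proof.
by move=> f0; rewrite -in_qpolyM -in_qpoly1; apply/in_qpolyXn_eq/strunc_sinv.
Qed.

Lemma residue_sq : residue sq = in_qpoly 'X^(n.+1) 'X.
Proof. by apply: residue_eqmodX => i lt_i; rewrite coef_poly lt_i coefX. Qed.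

Lemma residue_subst c k f p : (0 < k)%N -> eqmodX n.+1 (strunc f n) p ->
  residue (ssubst c k f) = in_qpoly 'X^(n.+1) (p \Po (c *: 'X^k)).
Proof.
move=> k_gt0 h; apply: residue_eqmodX.
apply: (@eqmodX_trans _ _ (strunc f n \Po (c *: 'X^k))).
  exact: strunc_ssubst.
exact: eqmodX_comp.
Qed.

Lemma residue_substM c k f g : (0 < k)%N ->
  residue (ssubst c k (smul f g)) = residue (ssubst c k f) * residue (ssubst c k g).
Proof.
move=> k_gt0; rewrite (residue_subst _ k_gt0 (@strunc_smul f g n)) comp_polyM in_qpolyM.
by rewrite !(residue_subst _ k_gt0 (@eqmodX_refl _ _ (strunc _ n))).
Qed.

Lemma residue_substV c k f : (0 < k)%N -> f 0%N = 1 ->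
  residue (ssubst c k (sinv f)) * residue (ssubst c k f) = 1.
Proof.
move=> k_gt0 f0; rewrite !(residue_subst _ k_gt0 (@eqmodX_refl _ _ (strunc _ n))).
rewrite -in_qpolyM -comp_polyM -in_qpoly1 -[1](comp_polyC 1 (c *: 'X^k)).
by apply/in_qpolyXn_eq/eqmodX_comp => //; apply: strunc_sinv.
Qed.

Lemma residue_qpoch_subst z a b c k : (0 < k)%N -> (0 < c)%N -> z ^+ c = 1 ->
  residue (ssubst z k (qpoch a b c)) = residue (qpoch (a * z ^+ b) (k * b) (k * c)).
Proof.
move=> k_gt0 c_gt0 zc.
rewrite (residue_subst _ k_gt0 (strunc_qpoch _ _ c_gt0 (ltnSn n))) fpoch_comp //.
by symmetry; apply/residue_eqmodX/strunc_qpoch; rewrite // muln_gt0 k_gt0.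
Qed.

Lemma in_qpoly_prod (I : Type) (s : seq I) (f : I -> {poly int}) :
  in_qpoly 'X^(n.+1) (\prod_(i <- s) f i) = \prod_(i <- s) in_qpoly 'X^(n.+1) (f i).
Proof. exact: (big_morph _ (@in_qpolyM _ _) (@in_qpoly1 _ _)). Qed.

Lemma residue_qpoch_residues m a b c : (0 < m)%N -> (0 < c)%N ->
  residue (qpoch a b c) = \prod_(i < m) residue (qpoch a (b + c * i) (c * m)).
Proof.
move=> m_gt0 c_gt0.
have lt_n : (n < m * n.+1)%N by rewrite leq_pmull.
rewrite (residue_eqmodX (strunc_qpoch _ _ c_gt0 lt_n)) fpoch_residues in_qpoly_prod.
apply: eq_bigr => i _; symmetry; apply/residue_eqmodX/strunc_qpoch => //.
by rewrite muln_gt0 c_gt0.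
Qed.

(** Splitting precedes the evaluation of the substitution because [z ^+ (c * m) = 1] may hold where
    [z ^+ c = 1] fails, as for [z = -1], [c = 1] and even [m]. *)
Lemma residue_subst_qpoch_residues z k m a b c : (0 < k)%N -> (0 < m)%N -> (0 < c)%N ->
  residue (ssubst z k (qpoch a b c)) =
  \prod_(i < m) residue (ssubst z k (qpoch a (b + c * i) (c * m))).
Proof.
move=> k_gt0 m_gt0 c_gt0.
have lt_n : (n < m * n.+1)%N by rewrite leq_pmull.
rewrite (residue_subst _ k_gt0 (strunc_qpoch _ _ c_gt0 lt_n)) fpoch_residues.
rewrite rmorph_prod in_qpoly_prod; apply: eq_bigr => i _; symmetry.
apply: (residue_subst _ k_gt0); apply: strunc_qpoch => //.
by rewrite muln_gt0 c_gt0.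
Qed.

Lemma residue_jacobi_triple a b N : (0 < a)%N -> (0 < b)%N -> (n < N)%N ->
  residue (qpoch (-1) a (a + b)) * residue (qpoch (-1) b (a + b)) *
    residue (qpoch 1 (a + b) (a + b)) = in_qpoly 'X^(n.+1) (theta _ a b N).
Proof.
move=> a_gt0 b_gt0 lt_n; have k_gt0 : (0 < a + b)%N by lia.
have /in_qpolyXn_eq <- := @jacobi_triple int a b n.+1 N a_gt0 b_gt0 lt_n.
by rewrite !in_qpolyM !(residue_eqmodX (strunc_qpoch _ _ k_gt0 lt_n)).
Qed.

End Residue.

(** * Assembly of the dissection *)

Lemma smul0 f g : smul f g 0%N = f 0%N * g 0%N.
Proof. by rewrite /smul big_ord1. Qed.

Lemma qpoch0 a b c : (0 < b)%N -> qpoch a b c 0%N = 1.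
Proof. exact: fpoch_coef0. Qed.

(** Here [L] is (-q;q^2), [E] is (q^4;q^4), [O] is (-q^2;q^4), and [G * H0], [G * H1] are F_0, F_1
    at -q^2. The relations give [H0 = G * t0], [H1 = G * t1] and [D = E * G * G], so both sides
    equal [G * G * (t0 + q * t1)]. *)
Lemma dissection_of_theta (A : comNzRingType) (q L E O G H0 H1 B0 B1 t0 t1 D : A) :
    D * (E * (O * O)) = 1 -> G * (O * E) = 1 -> H0 * B0 = 1 -> H1 * B1 = 1 ->
    B0 * t0 = O * E -> B1 * t1 = O * E -> L * E = t0 + q * t1 ->
  L * D = G * H0 + q * (G * H1).
Proof.
move=> eD eG eH0 eH1 e0 e1 eL.
have -> : H0 = G * t0.
  transitivity (H0 * (G * (O * E))); first by rewrite eG mulr1.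
  by rewrite -e0 -[t0]mul1r -[in RHS]eH0; ring.
have -> : H1 = G * t1.
  transitivity (H1 * (G * (O * E))); first by rewrite eG mulr1.
  by rewrite -e1 -[t1]mul1r -[in RHS]eH1; ring.
have -> : D = E * G * G.
  transitivity (D * ((G * (O * E)) * (G * (O * E)))); first by rewrite eG; ring.
  by rewrite -[E * G * G]mul1r -eD; ring.
by rewrite !mulrA eL; ring.
Qed.

(* (-q;q^2)_oo / ((q^4;q^4)_oo (-q^2;q^4)_oo^2) = F_0(-q^2) + q F_1(-q^2) *)
Theorem theorem1 :
  smul (qpoch (-1) 1 2)
       (sinv (smul (qpoch 1 4 4) (smul (qpoch (-1) 2 4) (qpoch (-1) 2 4))))
  = sadd (ssubst (-1) 2 (F 0)) (smul sq (ssubst (-1) 2 (F 1))).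
Proof.
apply: functional_extensionality => n.
set f := smul _ _; set g := sadd _ _.
suff : residue n f = residue n g.
  move/in_qpolyXn_eq => /(_ n (ltnSn n)).
  by rewrite !coef_poly ltnSn.
(* For an even step all exponents in the product share the parity of [b], hence a single sign. *)
have sub b c : (0 < c)%N -> ~~ odd c -> residue n (ssubst (-1) 2 (qpoch 1 b c)) =
    residue n (qpoch ((-1) ^+ odd b) (2 * b) (2 * c)).
  move=> c_gt0 evc; rewrite residue_qpoch_subst ?mul1r ?signr_odd //.
  by rewrite -signr_odd (negbTE evc).
have euler : residue n (ssubst (-1) 2 (qpoch 1 1 1)) =
    residue n (qpoch (-1) 2 4) * residue n (qpoch 1 4 4).
  by rewrite (@residue_subst_qpoch_residues _ _ _ 2) // !big_ord_recl big_ord0 mulr1 !sub.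
have euler8 : residue n (ssubst (-1) 2 (qpoch 1 1 1)) =
    \prod_(i < 8) residue n (ssubst (-1) 2 (qpoch 1 (1 + 1 * i) (1 * 8))).
  exact: residue_subst_qpoch_residues.
rewrite {}/f {}/g /F residueD !residueM residue_sq !residue_substM //.
apply: (dissection_of_theta
  (B0 := residue n (ssubst (-1) 2 (smul _ _)))
  (B1 := residue n (ssubst (-1) 2 (smul _ _)))
  (E := residue n (qpoch 1 4 4)) (O := residue n (qpoch (-1) 2 4))
  (t0 := in_qpoly _ (theta _ 6 10 n.+1)) (t1 := in_qpoly _ (theta _ 14 2 n.+1))).
- have := @residueV n (smul (qpoch 1 4 4) (smul (qpoch (-1) 2 4) (qpoch (-1) 2 4))).
  by rewrite !residueM; apply; rewrite !smul0 !qpoch0.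
- by rewrite -euler; apply: residue_substV; rewrite // qpoch0.
- by apply: residue_substV; rewrite // !smul0 !qpoch0.
- by apply: residue_substV; rewrite // !smul0 !qpoch0.
(* At -q^2, [B0] holds the classes 1, 2, 4, 6, 7 modulo 8; the three factors of [t0] are the classes
   3, 5 and 8. *)
- rewrite -euler euler8 -residue_jacobi_triple // !residue_substM //.
  rewrite !big_ord_recl big_ord0 !sub //; ring.
(* Likewise [B1] holds the classes 2 to 6, and [t1] the classes 1, 7 and 8. *)
- rewrite -euler euler8 -residue_jacobi_triple // !residue_substM //.
  rewrite !big_ord_recl big_ord0 !sub //; ring.
(* The even length [2 * n.+1] matches [theta_dissection]; (-q;q^2) is split modulo 4 to meet the
   triple product with [a = 1], [b = 3]. *)
- transitivity (in_qpoly 'X^(n.+1) (theta int 1 3 (2 * n.+1))); last first.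
    by rewrite theta_dissection in_qpolyD in_qpolyM.
  rewrite -residue_jacobi_triple //; last by lia.
  by rewrite (@residue_qpoch_residues _ 2) // !big_ord_recl big_ord0 mulr1.
Qed.
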